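(* There is a universal constant $C>0$ such that the following holds. Let $\mu,\nu$ be probability measures on a measurable space $\mathcal X$ with $\nu\ll\mu$, and let $g:\mathcal X\to(0,\infty)$ be bounded and measurable, with $\nu_g=\mathbb E_{\nu}[g]$. For i.i.d. $X_1,\dots,X_n\sim\mu$ let $$\hat g_{\mathrm{IS}}=\frac1n\sum_{i=1}^n\frac{d\nu}{d\mu}(X_i)\,g(X_i).$$ Let $\epsilon,\delta\in(0,1)$ and let $M_{\epsilon,\delta}>0$ satisfy $\mathrm{ICov}_{M_{\epsilon,\delta}}(g\nu\|\mu)\le \epsilon\delta M_{\epsilon,\delta}/6$. If $n\ge C\,M_{\epsilon,\delta}/\epsilon$, then with probability at least $1-\delta$, $|\hat g_{\mathrm{IS}}-\nu_g|\le\epsilon\,\nu_g$.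
   Context: $g\nu$ denotes the probability measure with density $\frac{g(x)}{\nu_g}\cdot\frac{d\nu}{d\mu}(x)$ with respect to $\mu$. For probability measures $\rho\ll\mu$ with $r=\frac{d\rho}{d\mu}$, the coverage is $\mathrm{Cov}_M(\rho\|\mu)=\rho(\{x:r(x)\ge M\})$ and the integrated coverage is $\mathrm{ICov}_M(\rho\|\mu)=\int_0^M\mathrm{Cov}_t(\rho\|\mu)\,dt$. *)

(* Defs.v *)
From HB Require Import structures.
From mathcomp Require Import all_boot all_order all_algebra.
From mathcomp Require Import all_classical all_reals all_analysis.
Set Implicit Arguments. Unset Strict Implicit. Unset Printing Implicit Defensive.
Import Order.TTheory GRing.Theory Num.Theory.
Local Open Scope classical_set_scope.
Local Open Scope ring_scope.
Local Open Scope ereal_scope.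

Definition is_density d (T : measurableType d) (R : realType)
  (mu nu : set T -> \bar R) (r : T -> R) : Prop :=
  measurable_fun setT r /\ (forall x, (0 <= r x)%R) /\
  (forall A, measurable A -> nu A = \int[mu]_(x in A) (r x)%:E).

Definition nug d (T : measurableType d) (R : realType)
  (nu : set T -> \bar R) (g : T -> R) : R :=
  fine (\int[nu]_x (g x)%:E).

(* the measure g nu, given by its density (g / nu_g) * r wrt mu *)
Definition gnu d (T : measurableType d) (R : realType)
  (mu : set T -> \bar R) (r g : T -> R) (ng : R) (A : set T) : \bar R :=
  \int[mu]_(x in A) ((g x / ng) * r x)%:E.

Definition Cov d (T : measurableType d) (R : realType)
  (mu : set T -> \bar R) (r g : T -> R) (ng : R) (M : R) : \bar R :=
  gnu mu r g ng [set x | (M <= (g x / ng) * r x)%R].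

Definition ICov d (T : measurableType d) (R : realType)
  (mu : set T -> \bar R) (r g : T -> R) (ng : R) (M : R) : \bar R :=
  \int[lebesgue_measure]_(t in `[0%R, M]) Cov mu r g ng t.

Definition iid_law d (T : measurableType d) dO (O : measurableType dO)
  (R : realType) (P : probability O R) (n : nat) (X : 'I_n -> O -> T)
  (mu : set T -> \bar R) : Prop :=
  (forall i, measurable_fun setT (X i)) /\
  (forall i A, measurable A -> P (X i @^-1` A) = mu A) /\
  (forall A : 'I_n -> set T, (forall i, measurable (A i)) ->
     P [set w | forall i, A i (X i w)] = \prod_(i < n) P (X i @^-1` A i)).

Definition gIS d (T : measurableType d) (O : Type) (R : realType) (n : nat)
  (X : 'I_n -> O -> T) (r g : T -> R) (w : O) : R :=
  ((\sum_(i < n) r (X i w) * g (X i w)) / n%:R)%R.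

(* Main.v *)
Require Import Defs.
From HB Require Import structures.
From mathcomp Require Import all_boot all_order all_algebra.
From mathcomp Require Import all_classical all_reals all_analysis.
From mathcomp Require Import measurable_realfun ring lra.
Set Implicit Arguments.
Unset Strict Implicit.
Unset Printing Implicit Defensive.
Import Order.TTheory GRing.Theory Num.Theory.
Local Open Scope classical_set_scope.
Local Open Scope ring_scope.

(** Write [f = (g / nu_g) * dnu/dmu] for the density of [g nu], so that [f] has
    [mu]-mean 1 and the relative error of the estimator is that of the empirical
    mean of [f].  Exchanging integrals, [ICov_M] is the [mu]-integral of
    [f * min f M].  Split [f = h + k], where [h] is [f] restricted to [f < M].
    The coverage bound controls both the mean of [k], by [eps * delta / 6], and
    the second moment of [h], by [eps * delta * M / 6].  Markov's inequality for
    [k] and Chebyshev's for [h] then bound the two deviations by [eps / 2] and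
    [eps / 3], and the truncation bias is at most [eps / 6]; [C = 3] suffices. *)

(** * Change of density and the truncated layer cake *)

(** [r] and the Radon-Nikodym derivative have the same [mu]-integral over every measurable set,
    hence agree almost everywhere, so change of variables for the derivative carries over to [r]. *)
Lemma integral_is_density (R : realType) (d : measure_display)
    (T : measurableType d) (mu nu : probability T R) (r : T -> R)
    (g : T -> \bar R) :
  is_density mu nu r -> nu.-integrable setT g ->
  (\int[nu]_x g x = \int[mu]_x (g x * (r x)%:E))%E.
Proof.
move=> [mr [r0 rE]] ig.
have numu : nu `<< mu.
  apply/null_content_dominatesP => A mA muA0.
  rewrite rE//; apply: null_set_integral => //.
  by apply/measurable_EFinP; apply: measurable_funTS.
rewrite -(Radon_Nikodym_change_of_variables numu)//.
apply: ae_eq_integral => //.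
- by apply: emeasurable_funM => //; exact: measurable_int ig.
- by apply: emeasurable_funM; [exact: measurable_int ig|exact/measurable_EFinP].
- apply: ae_eqe_mul2l; apply: integral_ae_eq => //.
  + exact: Radon_Nikodym_integrable.
  + exact/measurable_EFinP.
  + by move=> A _ mA; rewrite -Radon_Nikodym_integral//; exact: rE.
Qed.

(** Tonelli on the region under the graph of [f]: for fixed [x] the admissible [t] fill an interval
    of length [min (f x) M]. With [f] the density of [g nu], the left side is the integrated
    coverage. *)
Lemma layer_cake_truncated (R : realType) (d : measure_display)
    (T : measurableType d) (mu : {sigma_finite_measure set T -> \bar R})
    (f : T -> R) (M : R) :
  measurable_fun setT f -> (forall x, 0 <= f x) -> 0 <= M ->
  (\int[lebesgue_measure]_(t in `[0%R, M])
     \int[mu]_(x in [set x | (t <= f x)%R]) (f x)%:E =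
   \int[mu]_x (f x * Num.min (f x) M)%:E)%E.
Proof.
move=> mf f0 M0.
pose A := [set p : R * T | (0 <= p.1) && (p.1 <= M) && (p.1 <= f p.2)].
have mA : measurable A.
  have : measurable_fun setT (fun p : R * T =>
      (0 <= p.1) && (p.1 <= M) && (p.1 <= f p.2)).
    apply: measurable_and; first apply: measurable_and.
    - exact: measurable_fun_ler.
    - exact: measurable_fun_ler.
    - apply: measurable_fun_ler => //; exact: measurableT_comp.
  by move=> /(_ measurableT [set true]); rewrite setTI; exact.
pose F (p : R * T) : \bar R := (f p.2 * \1_A p)%:E.
have mF : measurable_fun setT F.
  apply/measurable_EFinP; apply: measurable_funM.
    exact: measurableT_comp.
  exact: measurable_indic.
have F0 p : (0 <= F p)%E by rewrite lee_fin mulr_ge0.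
(* The indicator of [A] absorbs both domain restrictions, leaving integrals over whole spaces whose
   order can be exchanged. *)
transitivity (\int[lebesgue_measure]_t \int[mu]_x F (t, x))%E.
  rewrite integral_mkcond; apply: eq_integral => t _.
  rewrite patchE; case: ifPn.
    rewrite inE/= in_itv/= => t0M; rewrite integral_mkcond; apply: eq_integral => x _.
    rewrite patchE /F/= indicE; case: ifPn; rewrite ?inE ?notin_setE/= => h.
      by rewrite mem_set ?mulr1// /A/= t0M.
    by rewrite memNset ?mulr0// /A/= t0M.
  rewrite notin_setE/= in_itv/= => t0M; rewrite integral0_eq// => x _.
  by rewrite /F/= indicE memNset ?mulr0// /A/= => /andP[].
rewrite (fubini_tonelli (m1:=lebesgue_measure) (m2:=mu))//.
apply: eq_integral => x _; rewrite /F/=.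
under eq_integral do rewrite EFinM.
rewrite ge0_integralZl_EFin//; last first.
  apply/measurable_EFinP; apply: measurableT_comp; first exact: measurable_indic.
  exact: pair2_measurable.
rewrite EFinM; congr (_ * _)%E.
transitivity (\int[lebesgue_measure]_t
    (\1_(`[0%R, Num.min (f x) M]%classic : set R) t)%:E)%E.
  apply: eq_integral => t _; rewrite !indicE; congr ((nat_of_bool _)%:R%:E).
  apply/idP/idP; rewrite !inE /A/= in_itv/= le_min.
    by move=> /andP[/andP[-> ->] ->].
  by move=> /and3P[-> -> ->].
rewrite integral_indic// setIT [LHS]lebesgue_measure_itv/= lte_fin.
have m0 : 0 <= Num.min (f x) M by rewrite le_min f0 M0.
(* The length formula tests [0 < min] strictly; in the other case the interval is a point and the
   minimum itself is 0. *)
case: ltP => [_|m0']; first by rewrite -EFinB subr0.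
by rewrite (_ : Num.min _ _ = 0) //; apply/eqP; rewrite eq_le m0 m0'.
Qed.

(** * Laws and independence of the samples *)

Lemma integral_comp_law (R : realType) (d dO : measure_display)
    (T : measurableType d) (O : measurableType dO) (P : probability O R)
    (mu : {measure set T -> \bar R}) (X : O -> T) (h : T -> \bar R) :
  measurable_fun setT X ->
  (forall A, measurable A -> P (X @^-1` A) = mu A) ->
  measurable_fun setT h -> (forall x, (0 <= h x)%E) ->
  (\int[P]_w h (X w) = \int[mu]_x h x)%E.
Proof.
move=> mX XE mh h0.
rewrite -(ge0_integral_pushforward mX P measurableT)//=.
by apply: eq_measure_integral => A mA _; exact: XE.
Qed.

(** The law of [(X, Y)] agrees with the product measure on rectangles, hence everywhere by
    uniqueness; Tonelli then factors the integral. *)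
Lemma integral_indep_pair (R : realType) (d dO : measure_display)
    (T : measurableType d) (O : measurableType dO) (P : probability O R)
    (mu : probability T R) (X Y : O -> T) (h k : T -> R) :
  measurable_fun setT X -> measurable_fun setT Y ->
  (forall A B, measurable A -> measurable B ->
    P (X @^-1` A `&` Y @^-1` B) = mu A * mu B)%E ->
  measurable_fun setT h -> measurable_fun setT k ->
  (forall x, 0 <= h x) -> (forall x, 0 <= k x) ->
  (\int[P]_w (h (X w) * k (Y w))%:E =
    \int[mu]_x (h x)%:E * \int[mu]_x (k x)%:E)%E.
Proof.
move=> mX mY XYE mh mk h0 k0.
have mXY : measurable_fun setT (fun w => (X w, Y w)).
  exact: measurable_fun_pair.
have mhk : measurable_fun setT (fun p : T * T => (h p.1 * k p.2)%:E).
  apply/measurable_EFinP; apply: measurable_funM; exact: measurableT_comp.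
have hk0 p : (0 <= (h p.1 * k p.2)%:E :> \bar R)%E by rewrite lee_fin mulr_ge0.
have ik0 : (0 <= \int[mu]_x (k x)%:E)%E.
  by apply: integral_ge0 => x _; rewrite lee_fin.
transitivity (\int[pushforward P (fun w => (X w, Y w))]_p (h p.1 * k p.2)%:E)%E.
  by rewrite (ge0_integral_pushforward mXY).
transitivity (\int[(mu \x mu)%E]_p (h p.1 * k p.2)%:E)%E.
  apply: eq_measure_integral => A mA _; apply/esym.
  by apply: product_measure_unique => // ? ? ? ?; exact: XYE.
rewrite fubini_tonelli1// /fubini_F/=.
transitivity (\int[mu]_x ((h x)%:E * \int[mu]_y (k y)%:E))%E.
  apply: eq_integral => x _; under eq_integral do rewrite EFinM.
  rewrite ge0_integralZl_EFin//; first by move=> y _; rewrite lee_fin.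
  exact/measurable_EFinP.
by rewrite ge0_integralZr//; [exact/measurable_EFinP|move=> x _; rewrite lee_fin].
Qed.

Lemma markov_ge0 (R : realType) (d : measure_display) (O : measurableType d)
    (P : {measure set O -> \bar R}) (Y : O -> R) (c : R) :
  measurable_fun setT Y -> (forall w, 0 <= Y w) -> 0 < c ->
  (P [set w | (c <= Y w)%R] <= (c^-1)%:E * \int[P]_w (Y w)%:E)%E.
Proof.
move=> mY Y0 c0; rewrite lee_pdivlMl//.
have mYE : measurable_fun setT (EFin \o Y) by exact/measurable_EFinP.
have := le_integral_abse P measurableT mYE c0.
rewrite setTI /= (_ : [set x | _] = [set w | c <= Y w]); last first.
  by apply/seteqP; split=> w /=; rewrite lee_fin ger0_norm.
move=> /le_trans; apply; rewrite le_eqVlt; apply/orP; left; apply/eqP.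
by apply: eq_integral => w _ /=; rewrite ger0_norm.
Qed.

(** Putting the whole space in every coordinate other than [i] and [j] turns the remaining factors
    of the product formula into 1. *)
Lemma iid_law_pair (R : realType) (d dO : measure_display)
    (T : measurableType d) (O : measurableType dO) (P : probability O R)
    (mu : probability T R) (n : nat) (X : 'I_n -> O -> T) (i j : 'I_n)
    (A B : set T) :
  iid_law P X mu -> i != j -> measurable A -> measurable B ->
  (P (X i @^-1` A `&` X j @^-1` B) = mu A * mu B)%E.
Proof.
move=> [mX [XE Xind]] ij mA mB.
pose F k := if k == i then A else if k == j then B else [set: T].
have mF k : measurable (F k) by rewrite /F; case: ifP => // _; case: ifP.
have := Xind _ mF; rewrite (_ : [set w | _] = X i @^-1` A `&` X j @^-1` B).
  move=> ->; rewrite (bigD1 i)//= (bigD1 j) 1?eq_sym//= big1 ?mule1.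
    by rewrite /F eqxx eq_sym (negbTE ij) eqxx !XE.
  move=> k /andP[ki kj]; rewrite /F (negbTE ki) (negbTE kj) preimage_setT.
  exact: probability_setT.
apply/seteqP; split=> w /=.
  move=> FX; have := FX i; have := FX j.
  by rewrite /F !eqxx eq_sym (negbTE ij).
by move=> [Ai Bj] k; rewrite /F; case: eqP => [->//|_]; case: eqP => [->|].
Qed.

(** * Moments of i.i.d. sums *)

Lemma iid_sum_mean (R : realType) (d dO : measure_display)
    (T : measurableType d) (O : measurableType dO) (P : probability O R)
    (mu : probability T R) (n : nat) (X : 'I_n -> O -> T) (h : T -> R) (m : R) :
  iid_law P X mu -> measurable_fun setT h -> (forall x, 0 <= h x) ->
  (\int[mu]_x (h x)%:E = m%:E)%E ->
  (\int[P]_w (\sum_(i < n) h (X i w))%:E = (n%:R * m)%:E)%E.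
Proof.
move=> [mX [XE _]] mh h0 hm.
under eq_integral do rewrite -sumEFin.
rewrite ge0_integral_sum//=; last 2 first.
  by move=> i; apply/measurable_EFinP; exact: measurableT_comp.
  by move=> i w _; rewrite lee_fin.
rewrite (eq_bigr (fun=> m%:E)) => [|i _].
  by rewrite sumEFin sumr_const card_ord mulr_natl.
rewrite -hm (@integral_comp_law _ _ _ _ _ P mu (X i) (EFin \o h))//.
- exact: XE.
- exact/measurable_EFinP.
Qed.

(** Cross terms factor by independence, so the variance is exactly [n * (s - m ^+ 2)]; the bound
    drops the negative term. *)
Lemma iid_sum_variance_le (R : realType) (d dO : measure_display)
    (T : measurableType d) (O : measurableType dO) (P : probability O R)
    (mu : probability T R) (n : nat) (X : 'I_n -> O -> T) (h : T -> R)
    (m s : R) :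
  iid_law P X mu -> measurable_fun setT h -> (forall x, 0 <= h x) ->
  (\int[mu]_x (h x)%:E = m%:E)%E -> (\int[mu]_x (h x ^+ 2)%:E = s%:E)%E ->
  (\int[P]_w ((\sum_(i < n) h (X i w) - n%:R * m) ^+ 2)%:E
    <= (n%:R * s)%:E)%E.
Proof.
move=> Xiid mh h0 hm hs; have [mX [XE _]] := Xiid.
have mhX i : measurable_fun setT (fun w => h (X i w)).
  exact: measurableT_comp.
pose S w := \sum_(i < n) h (X i w).
have mS : measurable_fun setT S by exact: measurable_sum.
have S0 w : 0 <= S w by apply: sumr_ge0.
have m0 : 0 <= m by rewrite -lee_fin -hm integral_ge0// => x _; rewrite lee_fin.
have iS : (\int[P]_w (S w)%:E = (n%:R * m)%:E)%E.
  exact: iid_sum_mean Xiid mh h0 hm.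
have iSS : (\int[P]_w (S w ^+ 2)%:E =
    (n%:R * s + n%:R * (n%:R - 1) * m ^+ 2)%:E)%E.
  (* Diagonal pairs contribute [s] and off-diagonal pairs [m ^+ 2]; this double sum is matched term
     by term with the expanded square. *)
  have -> : n%:R * s + n%:R * (n%:R - 1) * m ^+ 2 =
      \sum_(i < n) \sum_(j < n) (m ^+ 2 + (i == j)%:R * (s - m ^+ 2)).
    rewrite (eq_bigr (fun=> n%:R * m ^+ 2 + (s - m ^+ 2))) => [|i _].
      rewrite sumr_const card_ord -mulr_natl; ring.
    rewrite big_split/= sumr_const card_ord mulr_natl; congr +%R.
    rewrite (bigD1 i)//= eqxx mul1r big1 ?addr0// => j.
    by rewrite eq_sym => /negbTE ->; rewrite mul0r.
  have S2E w : (S w ^+ 2)%:E =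
      (\sum_(i < n) \sum_(j < n) (h (X i w) * h (X j w))%:E)%E.
    rewrite expr2 mulr_suml -sumEFin; apply: eq_bigr => i _.
    by rewrite mulr_sumr -sumEFin.
  under eq_integral do rewrite S2E.
  have mhh i j : measurable_fun setT (fun w => (h (X i w) * h (X j w))%:E).
    by apply/measurable_EFinP; exact: measurable_funM.
  have hh0 i j w : (0 <= (h (X i w) * h (X j w))%:E)%E.
    by rewrite lee_fin mulr_ge0.
  rewrite ge0_integral_sum//=; last 2 first.
    by move=> i; exact: emeasurable_sum.
    by move=> i w _; exact: sume_ge0.
  rewrite -sumEFin; apply: eq_bigr => i _.
  rewrite ge0_integral_sum//= -sumEFin; apply: eq_bigr => j _.
  have [<-|ij] := eqVneq i j.
    rewrite mul1r addrC subrK -hs.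
    rewrite (@integral_comp_law _ _ _ _ _ P mu (X i) (fun x => (h x * h x)%:E))//.
    - exact: XE.
    - by apply/measurable_EFinP; exact: measurable_funM.
    - by move=> x; rewrite lee_fin mulr_ge0.
  rewrite mul0r addr0 (@integral_indep_pair _ _ _ _ _ P mu (X i) (X j) h h)//.
    by rewrite hm -EFinM.
  by move=> A B mA mB; exact: iid_law_pair Xiid ij mA mB.
set V := (\int[P]_w _)%E.
have mD : measurable_fun setT (fun w => (S w - n%:R * m) ^+ 2).
  by apply: measurable_funX; exact: measurable_funB.
(* The cross term is moved to the side of [V]: the identity [(S - c)^2 + 2 c S = S^2 + c^2] with
   [c = n m] involves only nonnegative functions, so integrals add without any integrability
   argument. *)
have VE : (V + (2 * (n%:R * m) * (n%:R * m))%:E =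
    (n%:R * s + n%:R * (n%:R - 1) * m ^+ 2 + (n%:R * m) ^+ 2)%:E)%E.
  rewrite EFinM -iS -ge0_integralZl_EFin//; last 3 first.
  - by move=> w _; rewrite lee_fin.
  - exact/measurable_EFinP.
  - by rewrite !mulr_ge0.
  rewrite EFinD -iSS.
  have -> : ((n%:R * m) ^+ 2)%:E = (\int[P]_w ((n%:R * m) ^+ 2)%:E)%E.
    by rewrite integral_cst//= probability_setT mule1.
  rewrite /V -!ge0_integralD//=.
  - by apply: eq_integral => w _; rewrite -EFinM -!EFinD -/(S w); congr EFin; ring.
  - by move=> w _; rewrite lee_fin sqr_ge0.
  - by apply/measurable_EFinP; exact: measurable_funX.
  - by move=> w _; rewrite lee_fin sqr_ge0.
  - by move=> w _; rewrite lee_fin sqr_ge0.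
  - exact/measurable_EFinP.
  - by move=> w _; rewrite lee_fin !mulr_ge0.
  - by apply/measurable_EFinP; exact: measurable_funM.
(* The right side of [VE] is finite, which rules out infinite [V] and allows cancellation in the
   reals. *)
have : V = (n%:R * (s - m ^+ 2))%:E.
  move: VE; case: V => [v| |]//= [vE]; congr EFin.
  by apply: (addIr (2 * (n%:R * m) * (n%:R * m))); rewrite vE; ring.
by move=> ->; rewrite lee_fin ler_wpM2l// gerBl sqr_ge0.
Qed.

(** * Concentration of the empirical mean *)

Lemma iid_mean_concentration (R : realType) (d dO : measure_display)
    (T : measurableType d) (O : measurableType dO) (P : probability O R)
    (mu : probability T R) (n : nat) (X : 'I_n -> O -> T) (f : T -> R)
    (eps delta M : R) :
  iid_law P X mu -> measurable_fun setT f -> (forall x, 0 <= f x) ->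
  (\int[mu]_x (f x)%:E = 1)%E ->
  0 < eps < 1 -> 0 < delta < 1 -> 0 < M ->
  (\int[mu]_x (f x * Num.min (f x) M)%:E <= (eps * delta * M / 6)%:E)%E ->
  3 * M / eps <= n%:R ->
  ((1 - delta)%:E <=
    P [set w | (`|(\sum_(i < n) f (X i w)) / n%:R - 1| <= eps)%R])%E.
Proof.
move=> Xiid mf f0 f1 /andP[e0 e1] /andP[d0 d1] M0 fM nM.
have [mX _] := Xiid.
have n0 : 0 < n%:R :> R by apply: lt_le_trans nM; rewrite divr_gt0// mulr_gt0.
pose h x := if f x < M then f x else 0.
pose k x := if f x < M then 0 else f x.
have hk x : f x = h x + k x by rewrite /h /k; case: ifP; rewrite ?addr0 ?add0r.
have h0 x : 0 <= h x by rewrite /h; case: ifP.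
have k0 x : 0 <= k x by rewrite /k; case: ifP.
have mfM : measurable_fun setT (fun x => f x < M) by exact: measurable_fun_ltr.
have mh : measurable_fun setT h by exact: measurable_fun_ifT.
have mk : measurable_fun setT k by exact: measurable_fun_ifT.
have min0 x : 0 <= Num.min (f x) M by rewrite le_min f0 ltW.
have mfmin : measurable_fun setT (fun x => (f x * Num.min (f x) M)%:E).
  apply/measurable_EFinP; apply: measurable_funM => //.
  exact: measurable_minr.
have real_integral (p : T -> R) (c : R) : (forall x, 0 <= p x) ->
    (\int[mu]_x (p x)%:E <= c%:E)%E ->
    exists2 q, (\int[mu]_x (p x)%:E = q%:E)%E & 0 <= q <= c.
  move=> p0 pc.
  have i0 : (0 <= \int[mu]_x (p x)%:E)%E.
    by apply: integral_ge0 => x _; rewrite lee_fin.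
  move: i0 pc; case: (\int[mu]_x _)%E => [q| |]//; rewrite !lee_fin => q0 qc.
  by exists q => //; rewrite q0.
have hk1 : (\int[mu]_x (h x)%:E + \int[mu]_x (k x)%:E = 1)%E.
  rewrite -f1 -ge0_integralD//.
  - by apply: eq_integral => x _; rewrite -EFinD -hk.
  - by move=> x _; rewrite lee_fin.
  - exact/measurable_EFinP.
  - by move=> x _; rewrite lee_fin.
  - exact/measurable_EFinP.
(* Where [f < M] the minimum is [f], so [h ^+ 2] equals the integrand bounded by [fM]; elsewhere [h]
   vanishes. *)
have [s hs /andP[s0 sle]] : exists2 s, (\int[mu]_x (h x ^+ 2)%:E = s%:E)%E &
    0 <= s <= eps * delta * M / 6.
  apply: real_integral => [x|]; first exact: sqr_ge0.
  apply: le_trans fM; apply: ge0_le_integral => //.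
  - by move=> x _; rewrite lee_fin sqr_ge0.
  - by apply/measurable_EFinP; exact: measurable_funX.
  - move=> x _; rewrite lee_fin /h; case: ltP => [_|_].
      by rewrite expr2.
    by rewrite expr0n mulr_ge0// ltW.
have [q kq /andP[q0 qle]] : exists2 q, (\int[mu]_x (k x)%:E = q%:E)%E &
    0 <= q <= eps * delta / 6.
  apply: real_integral => //.
  (* After scaling by [M], the same integrand dominates [M * k]: the minimum is [M] wherever [k] can
     be nonzero. *)
  rewrite -(@lee_pmul2l _ M%:E)//.
  rewrite -ge0_integralZl_EFin//; last 3 first.
  - by move=> x _; rewrite lee_fin.
  - exact/measurable_EFinP.
  - exact: ltW.
  rewrite -EFinM (_ : M * _ = eps * delta * M / 6); last by lra.
  apply: le_trans fM; apply: ge0_le_integral => //.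
  - by move=> x _; rewrite lee_fin mulr_ge0// ltW.
  - by apply/measurable_EFinP; exact: measurable_funM.
  - move=> x _; rewrite lee_fin /k; case: ltP => [_|_].
      by rewrite mulr0 mulr_ge0.
    by rewrite mulrC.
have hm : (\int[mu]_x (h x)%:E = (1 - q)%:E)%E.
  move: hk1; rewrite kq; case: (\int[mu]_x _)%E => [m| |]//= [<-].
  by rewrite addrK.
have mhX : measurable_fun setT (fun w => \sum_(i < n) h (X i w)).
  by apply: measurable_sum => i; exact: measurableT_comp.
have mkX : measurable_fun setT (fun w => \sum_(i < n) k (X i w)).
  by apply: measurable_sum => i; exact: measurableT_comp.
have mfX : measurable_fun setT (fun w => \sum_(i < n) f (X i w)).
  by apply: measurable_sum => i; exact: measurableT_comp.
pose V w := (\sum_(i < n) h (X i w) - n%:R * (1 - q)) ^+ 2.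
have mV : measurable_fun setT V.
  by apply: measurable_funX; exact: measurable_funB.
(* The two bad events: the tail sum is too large, or the truncated sum strays from its mean. The
   second is squared to suit Chebyshev. *)
pose E1 := [set w | n%:R * eps / 2 <= \sum_(i < n) k (X i w)].
pose E2 := [set w | (n%:R * eps / 3) ^+ 2 <= V w].
have measurable_ge c (Y : O -> R) : measurable_fun setT Y ->
    measurable [set w | c <= Y w].
  move=> mY; have : measurable_fun setT (fun w => c <= Y w).
    exact: measurable_fun_ler.
  by move=> /(_ measurableT [set true]); rewrite setTI; exact.
have mE1 : measurable E1 by exact: measurable_ge.
have mE2 : measurable E2 by exact: measurable_ge.
(* Markov gives [q / (eps / 2)], and [q <= eps * delta / 6]. *)
have PE1 : (P E1 <= (delta / 3)%:E)%E.
  have c0 : 0 < n%:R * eps / 2 by rewrite divr_gt0// mulr_gt0.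
  apply: le_trans (markov_ge0 P mkX _ c0) _.
    by move=> w; exact: sumr_ge0.
  rewrite (iid_sum_mean Xiid mk k0 kq) -EFinM lee_fin.
  rewrite ler_pdivrMl//; nra.
(* Chebyshev gives [9 s / (n eps^2)], at most [3 delta M / (2 n eps)]; this is below [delta / 2]
   exactly when [n >= 3 M / eps], whence the constant 3. *)
have PE2 : (P E2 <= (delta / 2)%:E)%E.
  have c0 : 0 < (n%:R * eps / 3) ^+ 2 by rewrite exprn_gt0// divr_gt0// mulr_gt0.
  apply: le_trans (markov_ge0 P mV _ c0) _.
    by move=> w; exact: sqr_ge0.
  rewrite lee_pdivrMl//.
  apply: le_trans (iid_sum_variance_le Xiid mh h0 hm hs) _.
  rewrite -EFinM lee_fin.
  have -> : (n%:R * eps / 3) ^+ 2 * (delta / 2) =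
      n%:R * (eps * delta / 18 * (n%:R * eps)) by field.
  rewrite ler_pM2l//; apply: le_trans sle _.
  move: nM; rewrite ler_pdivrMr// => nM.
  have -> : eps * delta * M / 6 = eps * delta / 18 * (3 * M) by field.
  by rewrite ler_pM2l// divr_gt0// mulr_gt0.
have PE : (P (E1 `|` E2) <= delta%:E)%E.
  apply: le_trans (measureU2 _ _ _) _ => //.
  apply: le_trans (leeD PE1 PE2) _; rewrite -EFinD lee_fin; lra.
have mE : measurable (E1 `|` E2) by exact: measurableU.
apply: (@le_trans _ _ (P (~` (E1 `|` E2)))).
  by rewrite probability_setC// EFinB leeB.
apply: le_measure; rewrite ?inE.
- exact: measurableC.
- have : measurable_fun setT
      (fun w => `|(\sum_(i < n) f (X i w)) / n%:R - 1| <= eps).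
    apply: measurable_fun_ler => //; apply: measurableT_comp => //.
    by apply: measurable_funB => //; exact: measurable_funM.
  by move=> /(_ measurableT [set true]); rewrite setTI; exact.
move=> w /=; rewrite /E1 /E2 /V /= => /not_orP[/negP + /negP].
rewrite -!ltNge.
have SE : \sum_(i < n) f (X i w) =
    \sum_(i < n) h (X i w) + \sum_(i < n) k (X i w).
  by rewrite -big_split/=; apply: eq_bigr => i _; exact: hk.
have K0 : 0 <= \sum_(i < n) k (X i w) by exact: sumr_ge0.
rewrite SE; move: K0.
set H := \sum_(i < n) h _; set K := \sum_(i < n) k _ => K0 Klt.
(* Both squares become squares of absolute values, so that the square can be removed from the
   inequality. *)
rewrite -[ltRHS](real_normK (num_real _)) -[ltLHS](real_normK (num_real _)) ltr_pXn2r ?nnegrE//.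
rewrite (ger0_norm (x := n%:R * eps / 3)); last first.
  by rewrite divr_ge0// mulr_ge0// ltW.
rewrite ltr_norml => /andP[Hgt Hlt].
have nq0 : 0 <= n%:R * q by rewrite mulr_ge0// ltW.
have nq : n%:R * q <= n%:R * eps / 6.
  by rewrite -mulrA ler_pM2l//; nra.
(* For the upper side [eps / 3 + eps / 2] suffices; for the lower side [K >= 0] is dropped and the
   bias costs [eps / 6] on top of [eps / 3]. *)
rewrite ler_norml lerBrDr lerBlDr ler_pdivlMr// ler_pdivrMr//.
apply/andP; split; lra.
Qed.

(** * Application to the importance sampling estimator *)

(** A zero integral would make [g] vanish almost everywhere; as [g] vanishes nowhere, the
    exceptional null set would be the whole space, of mass 1. This permits division by [nu_g]. *)
Lemma integral_probability_gt0 (R : realType) (d : measure_display)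
    (T : measurableType d) (nu : probability T R) (g : T -> R) :
  measurable_fun setT g -> (forall x, 0 < g x) ->
  (0 < \int[nu]_x (g x)%:E)%E.
Proof.
move=> mg g0; rewrite lt0e integral_ge0 ?andbT; last first.
  by move=> x _; rewrite lee_fin ltW.
apply/eqP => ig0.
have mgE : measurable_fun setT (EFin \o g) by exact/measurable_EFinP.
have : (\int[nu]_x `|(EFin \o g) x| = 0)%E.
  by rewrite -ig0; apply: eq_integral => x _ /=; rewrite gtr0_norm.
move=> /(ae_eq_integral_abs nu measurableT mgE)[N [mN N0 gN]].
have NT : N = setT.
  apply/seteqP; split=> // x _; apply: gN => /=.
  by move=> /(_ Logic.I)[] /eqP; rewrite gt_eqF.
have := probability_setT nu; rewrite -NT => N1.
by have /eqP := etrans (esym N1) N0; rewrite onee_eq0.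
Qed.

Theorem theorem14 (R : realType) :
  exists C : R, 0 < C /\
  forall (d : measure_display) (T : measurableType d)
    (mu nu : probability T R) (r : T -> R) (g : T -> R),
    is_density mu nu r ->
    measurable_fun setT g ->
    (forall x, 0 < g x) ->
    (exists B : R, forall x, g x <= B) ->
    forall (eps delta M : R),
    0 < eps < 1 -> 0 < delta < 1 -> 0 < M ->
    (ICov mu r g (nug nu g) M <= (eps * delta * M / 6)%:E)%E ->
    forall (n : nat), C * M / eps <= n%:R ->
    forall (dO : measure_display) (O : measurableType dO) (P : probability O R)
      (X : 'I_n -> O -> T),
    iid_law P X mu ->
    ((1 - delta)%:E <=
      P [set w | (`|gIS X r g w - nug nu g| <= eps * nug nu g)%R])%E.
Proof.
exists 3; split=> // d T mu nu r g rdens mg g0 [B gB] eps delta M e01 d01 M0.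
move=> iM n nM dO O P X Xiid.
have [mr [r0 _]] := rdens.
have ig : nu.-integrable setT (EFin \o g).
  apply: (@le_integrable _ _ _ nu _ measurableT _ (cst B%:E)).
  - exact/measurable_EFinP.
  - move=> x _ /=; rewrite lee_fin gtr0_norm// ger0_norm//.
    by apply: le_trans (gB x); exact: ltW.
  - exact: finite_measure_integrable_cst.
(* Boundedness of [g] keeps [fine] away from its default value at infinity. *)
have ngE : (\int[nu]_x (g x)%:E = (nug nu g)%:E)%E.
  by rewrite /nug fineK//; exact: integrable_fin_num.
have ng0 : 0 < nug nu g.
  by rewrite -lte_fin -ngE; exact: integral_probability_gt0.
move: iM; rewrite /ICov /Cov /gnu.
set ng := nug nu g in ngE ng0 *.
pose f x := g x / ng * r x.
have f0 x : 0 <= f x by rewrite /f mulr_ge0// divr_ge0// ltW.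
have mf : measurable_fun setT f.
  by apply: measurable_funM => //; exact: measurable_funM.
have f1 : (\int[mu]_x (f x)%:E = 1)%E.
  transitivity (\int[mu]_x ((ng^-1)%:E * ((EFin \o g) x * (r x)%:E)))%E.
    apply: eq_integral => x _; rewrite /= -!EFinM; congr EFin.
    by rewrite /f; ring.
  rewrite ge0_integralZl_EFin//; last 3 first.
  - by move=> x _; rewrite -EFinM lee_fin mulr_ge0// ltW.
  - by apply/measurable_EFinP; exact: measurable_funM.
  - by rewrite invr_ge0 ltW.
  by rewrite -(integral_is_density rdens ig) ngE -EFinM mulVf// gt_eqF.
(* The coverage hypothesis becomes the bound on the integral of [f * min f M]. *)
rewrite -/(f _) (layer_cake_truncated mu mf f0 (ltW M0)) => iM.
have := iid_mean_concentration Xiid mf f0 f1 e01 d01 M0 iM nM.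
congr (_ <= P _)%E; congr mkset; apply/funext => w.
(* Factoring out [ng > 0] turns the error into the relative error, the deviation of the mean of [f]
   from 1. *)
have -> : gIS X r g w - ng = ((\sum_(i < n) f (X i w)) / n%:R - 1) * ng.
  rewrite mulrBl mul1r /gIS [in RHS]mulrAC [in RHS]mulr_suml; congr (_ / _ - _).
  apply: eq_bigr => i _; rewrite /f; field; exact: lt0r_neq0.
by rewrite normrM (gtr0_norm ng0) ler_pM2r.
Qed.
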